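(* Let $q$ be a prime power and let $\mu_{a,b}$ ($1\le a\le q^2$, $1\le b\le q$) be nonnegative integers, with the rational points $P_{a,b}=(\alpha_a,\beta_{a,b})$ of the Hermitian curve $H$ indexed so that $\mu_{a,1}\ge\mu_{a,2}\ge\cdots\ge\mu_{a,q}$ for each $a$. For $1\le b<c\le q$, suppose that $f_{b,c}\in\mathbb{F}[x]$ satisfy $$v_{P_{a,b}}(y-f_{b,c})\ge\mu_{a,b}-\mu_{a,c}$$ for all $1\le a\le q^2$. Define for $c=1,2,\dots,q$ $$g_c=\prod_{1\le a\le q^2}(x-\alpha_a)^{\mu_{a,c}}\prod_{1\le b<c}(y-f_{b,c}).$$ Then $J_N=\langle g_1,g_2,\dots,g_q\rangle$ as a module over $\mathbb{F}[x]$, where $$J_N=\{f\in R\mid v_{P_{a,b}}(f)\ge\mu_{a,b}\text{ for }1\le a\le q^2\text{ and }1\le b\le q\}.$$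
   Context: $\mathbb{F}$ is a finite field with $q^2$ elements. The Hermitian curve $H$ is the affine plane curve $Y^q+Y-X^{q+1}=0$ over $\mathbb{F}$, with coordinate ring $R=\mathbb{F}[X,Y]/\langle Y^q+Y-X^{q+1}\rangle=\mathbb{F}[x,y]$, which is a free $\mathbb{F}[x]$-module with basis $1,y,\dots,y^{q-1}$. For each $\alpha\in\mathbb{F}$ there are exactly $q$ elements $\beta\in\mathbb{F}$ with $\beta^q+\beta=\alpha^{q+1}$, so $H$ has $q^3$ rational points, grouped into $q^2$ classes of $q$ points with the same $x$-coordinate: $P_{a,b}=(\alpha_a,\beta_{a,b})$, where $\alpha_1,\dots,\alpha_{q^2}$ are the distinct elements of $\mathbb{F}$ and, for each $a$, $\beta_{a,1},\dots,\beta_{a,q}$ are the distinct solutions of $\beta^q+\beta=\alpha_a^{q+1}$. For a rational point $P$ of $H$, $\mathfrak{m}_P=\{f\in R\mid f(P)=0\}$, and for nonzero $f\in R$, $v_P(f)$ is the largest integer $r$ with $f\in\mathfrak{m}_P^r$ ($v_P(0)=\infty$). *)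

(* Defs.v *)
From HB Require Import structures.
From mathcomp Require Import all_boot all_order all_algebra qpoly.
From mathcomp Require Import boolp classical_sets constructive_ereal.

Set Implicit Arguments.
Unset Strict Implicit.
Unset Printing Implicit Defensive.

Import Order.TTheory GRing.Theory Num.Theory.
Local Open Scope ring_scope.

Definition prime_power (q : nat) : Prop :=
  exists p k : nat, [/\ prime p, (0 < k)%N & q = (p ^ k)%N].

Section Ideals.
Variable A : comNzRingType.

Definition ideal_mul (I J : set A) : set A :=
  fun f => exists (n : nat) (s t : 'I_n -> A),
    [/\ forall i, I (s i), forall i, J (t i) & f = \sum_(i < n) s i * t i].

Fixpoint ideal_pow (I : set A) (r : nat) : set A :=
  if r is r'.+1 then ideal_mul I (ideal_pow I r') else setT.

(* The largest r with f in I^r, and +oo for f = 0. When f <> 0 has no largest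
   such r, the value is the irrelevant 0; this does not happen for the
   ideal of a point of the curve below. *)
Definition ideal_val (I : set A) (f : A) : \bar int :=
  if f == 0 then +oo%E
  else ((xget 0%N (fun r : nat => ideal_pow I r f /\
                     forall s : nat, ideal_pow I s f -> (s <= r)%N))%:Z)%:E%E.

End Ideals.

Section HermitianCurve.
Variables (F : finFieldType) (q : nat).

(* An element of F[X,Y] is represented in {poly {poly F}}: the outer variable
   is Y and the inner one is X. *)
Definition hermitian_poly : {poly {poly F}} := 'X^q + 'X - ('X^(q.+1))%:P.

(* {poly %/ h} is the quotient by h only when h is monic of size > 1;
   mk_monic_hermitian shows that this is the case. *)
Notation hermitian_ring := {poly %/ hermitian_poly}.

Lemma size_hermitian_poly : (1 < q)%N -> size hermitian_poly = q.+1.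
Proof.
move=> q1; rewrite /hermitian_poly -addrA size_polyDl size_polyXn //.
rewrite (leq_ltn_trans (size_polyD _ _)) // size_polyX size_polyN.
by rewrite gtn_max !ltnS q1 (leq_trans (size_polyC_leq1 _)) // ltnW.
Qed.

Lemma monic_hermitian_poly : (1 < q)%N -> hermitian_poly \is monic.
Proof.
move=> q1; rewrite monicE lead_coefE size_hermitian_poly //=.
rewrite /hermitian_poly coefB coefD coefXn eqxx coefX coefC.
by rewrite gtn_eqF // gtn_eqF ?subr0 ?addr0 // ltnW.
Qed.

Lemma mk_monic_hermitian : (1 < q)%N ->
  mk_monic hermitian_poly = hermitian_poly.
Proof.
move=> q1; rewrite /mk_monic monic_hermitian_poly //.
by rewrite size_hermitian_poly // ltnS ltnW.
Qed.

Definition x_ : hermitian_ring := in_qpoly hermitian_poly ('X)%:P.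
Definition y_ : hermitian_ring := in_qpoly hermitian_poly 'X.

Definition on_curve (P : F * F) : Prop := P.2 ^+ q + P.2 = P.1 ^+ q.+1.

(* f(P), computed on the representative of f of Y-degree less than q; for P on
   the curve any representative will do, see curve_eval_in_qpoly. *)
Definition curve_eval (f : hermitian_ring) (P : F * F) : F :=
  (f : {poly {poly F}}).[(P.2)%:P].[P.1].

Lemma curve_eval_in_qpoly (P : F * F) (p : {poly {poly F}}) :
  (1 < q)%N -> on_curve P ->
  curve_eval (in_qpoly hermitian_poly p) P = p.[(P.2)%:P].[P.1].
Proof.
move=> q1 onP; rewrite /curve_eval /= mk_monic_hermitian //.
rewrite [in RHS](Pdiv.RingMonic.rdivp_eq (monic_hermitian_poly q1) p).
have h0 : hermitian_poly.[(P.2)%:P].[P.1] = 0.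
  by move: onP; rewrite /on_curve !hornerE => ->; rewrite subrr.
by rewrite hornerD hornerM hornerD hornerM h0 mulr0 add0r.
Qed.

Definition point_ideal (P : F * F) : set hermitian_ring :=
  fun f => curve_eval f P = 0.

Definition val_at (P : F * F) (f : hermitian_ring) : \bar int :=
  ideal_val (point_ideal P) f.

(* The points P_{a,b} = (alpha a, beta a b) are indexed from 0. *)
Definition J_N (alpha : 'I_(q ^ 2) -> F) (beta : 'I_(q ^ 2) -> 'I_q -> F)
    (mu : 'I_(q ^ 2) -> 'I_q -> nat) : set hermitian_ring :=
  fun f => forall a b, (((mu a b)%:Z)%:E <= val_at (alpha a, beta a b) f)%E.

Definition g_ (alpha : 'I_(q ^ 2) -> F) (mu : 'I_(q ^ 2) -> 'I_q -> nat)
    (f : 'I_q -> 'I_q -> {poly F}) (c : 'I_q) : hermitian_ring :=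
  (\prod_(a < q ^ 2) (x_ - ((alpha a)%:P)%:A) ^+ mu a c) *
  \prod_(b < q | (b < c)%N) (y_ - (f b c)%:A).

Definition Fx_span (n : nat) (g : 'I_n -> hermitian_ring) :
    set hermitian_ring :=
  fun h => exists u : 'I_n -> {poly F}, h = \sum_(c < n) u c *: g c.

End HermitianCurve.

(* Main.v *)
(* Over each rational point P = (a, b) the curve has a branch y = T(x), known to
   any (x - a)-adic precision; if f is in m_P^r then (x - a)^r divides f(x, T).
   If f has y-degree at most c and lies in m_P^m for c + 1 points P over x = a,
   reducing at x = a and cancelling x - a shows that (x - a)^m divides every
   coefficient of f. So the leading coefficient of an f in J_N of y-degree c is
   a multiple of that of g_c, and subtracting a multiple of g_c lowers the
   y-degree. Comparing J_N with powers of the m_P also needs that the m_P^r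
   intersect in 0: the resultant of f with the curve equation is a nonzero
   polynomial in x, so it is not divisible by all powers of x - a. *)

Require Import Defs.
From HB Require Import structures.
From mathcomp Require Import all_boot all_order all_algebra qpoly.
From mathcomp Require Import boolp classical_sets constructive_ereal.
From mathcomp Require Import finfield ring zify.

Set Implicit Arguments.
Unset Strict Implicit.
Unset Printing Implicit Defensive.

Import Order.TTheory GRing.Theory Num.Theory.
Local Open Scope ring_scope.

(** * Powers of an ideal and the valuation they define *)

Lemma ideal_mul0 (A : comNzRingType) (I J : set A) : ideal_mul I J 0.
Proof.
by exists 0%N, (fun=> 0), (fun=> 0); split=> [[]|[]|] //; rewrite big_ord0.
Qed.

Lemma ideal_mulD (A : comNzRingType) (I J : set A) (f g : A) :
  ideal_mul I J f -> ideal_mul I J g -> ideal_mul I J (f + g).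
Proof.
move=> [m [s [t [Is Jt ->]]]] [n [s' [t' [Is' Jt' ->]]]].
pose glue (u : 'I_m -> A) (u' : 'I_n -> A) (i : 'I_(m + n)) :=
  match split i with inl j => u j | inr j => u' j end.
exists (m + n)%N, (glue s s'), (glue t t'); split.
- by move=> i; rewrite /glue; case: split.
- by move=> i; rewrite /glue; case: split.
rewrite big_split_ord /=; congr (_ + _); apply: eq_bigr => i _.
  by rewrite /glue; have /= -> := unsplitK (inl i).
by rewrite /glue; have /= -> := unsplitK (inr i).
Qed.

(** The multiplier moves into the second factors, down to the zeroth power, which is the whole
    ring. *)
Lemma ideal_powMl (A : comNzRingType) (I : set A) r (a f : A) :
  ideal_pow I r f -> ideal_pow I r (a * f).
Proof.
elim: r f => [//|r IHr] f [n [s [t [Is It ->]]]].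
exists n, s, (fun i => a * t i); split=> //; first by move=> i; apply/IHr/It.
by rewrite mulr_sumr; apply: eq_bigr => i _; rewrite mulrCA.
Qed.

Lemma ideal_pow0 (A : comNzRingType) (I : set A) r : ideal_pow I r 0.
Proof. by case: r => [//|r]; apply: ideal_mul0. Qed.

Lemma ideal_powD (A : comNzRingType) (I : set A) r (f g : A) :
  ideal_pow I r f -> ideal_pow I r g -> ideal_pow I r (f + g).
Proof. by case: r => [//|r]; apply: ideal_mulD. Qed.

Lemma ideal_pow_sum (A : comNzRingType) (I : set A) r n (f : 'I_n -> A) :
  (forall i, ideal_pow I r (f i)) -> ideal_pow I r (\sum_(i < n) f i).
Proof.
move=> If; apply: big_ind => //; first exact: ideal_pow0.
exact: ideal_powD.
Qed.

Lemma ideal_pow_le (A : comNzRingType) (I : set A) (r s : nat) (f : A) :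
  (s <= r)%N -> ideal_pow I r f -> ideal_pow I s f.
Proof.
move/subnK <-; elim: (r - s)%N f => [//|k IHk] f [n [u [v [_ Iv ->]]]].
by apply: IHk; apply: ideal_pow_sum => i; apply/ideal_powMl/Iv.
Qed.

Lemma ideal_powM (A : comNzRingType) (I : set A) (r s : nat) (f g : A) :
  ideal_pow I r f -> ideal_pow I s g -> ideal_pow I (r + s) (f * g).
Proof.
move=> If Ig; elim: r f If => [f _|r IHr f [n [u [v [Iu Iv ->]]]]].
  exact: ideal_powMl.
exists n, u, (fun i => v i * g); split=> //; first by move=> i; apply/IHr/Iv.
by rewrite mulr_suml; apply: eq_bigr => i _; rewrite mulrA.
Qed.

Lemma ideal_pow_exp (A : comNzRingType) (I : set A) (r : nat) (f : A) :
  I f -> ideal_pow I r (f ^+ r).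
Proof.
move=> If; elim: r => [//|r IHr].
exists 1%N, (fun=> f), (fun=> f ^+ r); split=> //.
by rewrite big_ord1 exprS.
Qed.

Lemma ideal_pow_of_val (A : comNzRingType) (I : set A) (r : nat) (f : A) :
  (r%:Z%:E <= ideal_val I f)%E -> ideal_pow I r f.
Proof.
rewrite /ideal_val; have [-> _|_] := eqVneq f 0; first exact: ideal_pow0.
rewrite lee_fin lez_nat.
case: xgetP => [s _ [Is _]|_]; first by move/ideal_pow_le; apply.
(* Without a largest exponent the value defaults to 0, and the zeroth power is the whole ring. *)
by rewrite leqn0 => /eqP ->.
Qed.

(** The premise bounds the exponents of a nonzero [f], so a largest one exists and [ideal_val] does
    not fall back on its default. *)
Lemma ideal_val_of_pow (A : comNzRingType) (I : set A) (r : nat) (f : A) :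
    (f != 0 -> exists s, ~ ideal_pow I s f) ->
  ideal_pow I r f -> (r%:Z%:E <= ideal_val I f)%E.
Proof.
rewrite /ideal_val; have [-> _ _|_ /(_ isT) [s Is] Ir] := eqVneq f 0.
  by rewrite leey.
have leI i : ideal_pow I i f -> (i <= s)%N.
  by move=> Ii; rewrite leqNgt; apply/negP => /ltnW/ideal_pow_le/(_ Ii).
have exI : exists i, `[< ideal_pow I i f >] by exists r; apply/asboolP.
have leI' i : `[< ideal_pow I i f >] -> (i <= s)%N by move/asboolP/leI.
rewrite lee_fin lez_nat; case: xgetP => [k _ [_ ->] //|noI].
have [k /asboolP Ik maxk] := ex_maxnP exI leI'.
by case: (noI k); split=> // j /asboolP/maxk.
Qed.

(** * Frobenius and local branches of the curve *)

Lemma exprB_pchar (R : comNzRingType) (n : nat) (x y : R) :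
  [pchar R].-nat n -> (x - y) ^+ n = x ^+ n - y ^+ n.
Proof.
by move=> Rn; rewrite -[in RHS](subrK y x) [in RHS]exprDn_pchar // addrK.
Qed.

(** The order of [F] forces [q] to be a power of the characteristic; this form makes q-th powers
    additive in F[x]. *)
Lemma pchar_nat_poly (F : finFieldType) (q : nat) :
  prime_power q -> #|F| = (q ^ 2)%N -> [pchar {poly F}].-nat q.
Proof.
move=> [p [k [p_pr _ ->]]]; rewrite -expnM => /card_finPcharP /(_ p_pr) pF.
by rewrite pnatX pnatE // pchar_poly pF.
Qed.

Lemma prime_power_gt1 (q : nat) : prime_power q -> (1 < q)%N.
Proof.
by move=> [p [k [p_pr k0 ->]]]; rewrite -(exp1n k) ltn_exp2r // prime_gt1.
Qed.

Lemma horner_hermitian (F : finFieldType) (q : nat) (T : {poly F}) :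
  (hermitian_poly F q).[T] = T ^+ q + T - 'X^(q.+1).
Proof. by rewrite /hermitian_poly !hornerE. Qed.

(* Iterating [T |-> x^(q+1) - T^q] converges [(x - a)]-adically, because the
   Frobenius map is contracting. *)
Lemma hermitian_local_branch (F : finFieldType) (q r : nat) (P : F * F) :
    (1 < q)%N -> [pchar {poly F}].-nat q -> on_curve q P ->
  exists2 T : {poly F}, T.[P.1] = P.2 &
    ('X - P.1%:P) ^+ r %| (hermitian_poly F q).[T].
Proof.
move=> q1 Fq onP.
(* The induction starts at exponent 1: multiplying an exponent by [q] raises it only if it is
   positive. *)
suff [T TP dvdT] : exists2 T : {poly F}, T.[P.1] = P.2 &
    ('X - P.1%:P) ^+ r.+1 %| (hermitian_poly F q).[T].
  by exists T => //; apply: dvdp_trans dvdT; rewrite dvdp_exp2l.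
elim: r => [|r [T TP dvdT]].
  exists P.2%:P; first by rewrite hornerC.
  rewrite expr1 dvdp_XsubCl /root horner_hermitian !hornerE.
  by rewrite onP subrr.
exists ('X^(q.+1) - T ^+ q).
  by rewrite !hornerE TP -onP addrAC subrr add0r.
set h := hermitian_poly F q in dvdT *.
have hT : 'X^(q.+1) - T ^+ q = T - h.[T].
  by rewrite horner_hermitian; ring.
(* The new approximation is T - h(T); since q-th powers are additive, the error h(T) becomes
   -h(T)^q. *)
have -> : h.['X^(q.+1) - T ^+ q] = - h.[T] ^+ q.
  by rewrite [LHS]horner_hermitian {1}hT exprB_pchar //; ring.
rewrite dvdpNr (dvdp_trans _ (dvdp_exp2r q dvdT)) // -exprM dvdp_exp2l //.
by rewrite (leq_trans _ (leq_mul (leqnn _) q1)) // muln2 -addnn -addn1 leq_add.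
Qed.

(** * No proper factor of the curve equation, by pole orders *)

(* Substituting [x := z^q, y := z^(q+1)] reads off the pole order at infinity:
   the monomials [x^m y^i] with [i < q] get pairwise distinct exponents. *)
Definition infinity_sub (F : fieldType) (q : nat) (p : {poly {poly F}}) :
    {poly F} :=
  (map_poly (comp_poly 'X^q) p).['X^(q.+1)].

Lemma infinity_subM (F : fieldType) (q : nat) (p1 p2 : {poly {poly F}}) :
  infinity_sub q (p1 * p2) = infinity_sub q p1 * infinity_sub q p2.
Proof. by rewrite /infinity_sub rmorphM hornerM. Qed.

Lemma infinity_subZ (F : fieldType) (q : nat) (c : {poly F})
    (p : {poly {poly F}}) :
  infinity_sub q (c *: p) = (c \Po 'X^q) * infinity_sub q p.
Proof. by rewrite /infinity_sub map_polyZ hornerZ. Qed.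

(** The images of y^q and x^(q+1) cancel, leaving that of y. *)
Lemma infinity_sub_hermitian (F : finFieldType) (q : nat) :
  infinity_sub q (hermitian_poly F q) = 'X^(q.+1).
Proof.
rewrite /infinity_sub /hermitian_poly rmorphB rmorphD /= map_polyXn map_polyX.
rewrite map_polyC /= rmorphXn /= comp_polyX !hornerE -!exprM mulnC.
by rewrite addrAC subrr add0r.
Qed.

(** Modulo [q] the exponent is [i]; as [i < q], it determines [i] and then [m], so no other monomial
    contributes. *)
Lemma coef_infinity_sub (F : fieldType) (q m i : nat) (p : {poly {poly F}}) :
    (size p <= q)%N -> (i < q)%N ->
  (infinity_sub q p)`_(q * m + q.+1 * i) = p`_i`_m.
Proof.
move=> szp iq; have q0 : (0 < q)%N by apply: leq_ltn_trans iq.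
rewrite /infinity_sub (@horner_coef_wide _ q); last first.
  by rewrite (leq_trans (size_poly _ _)).
rewrite coef_sum (bigD1 (Ordinal iq)) //= big1 ?addr0 => [|j neq_ji].
  rewrite coef_map /= -exprM coefMXn ltnNge leq_addl addnK /=.
  by rewrite coef_comp_poly_Xn // dvdn_mulr // mulKn.
rewrite coef_map /= -exprM coefMXn; case: ltnP => // le_j.
rewrite coef_comp_poly_Xn //; case: ifP => // /dvdnP [k Dk].
case/eqP: neq_ji; apply/val_inj => /=.
have E : (q * (m + i) + i = q * (k + j) + j)%N.
  by move: (ltn_ord j) Dk le_j; rewrite !mulSn !mulnDr; lia.
have := congr1 (modn^~ q) E.
by rewrite !(mulnC q) !modnMDl !modn_small // => ->.
Qed.

(** The top monomial of the leading coefficient survives the substitution. This is only a lower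
    bound, since another monomial may have a larger exponent. *)
Lemma size_infinity_sub (F : fieldType) (q : nat) (p : {poly {poly F}}) :
    p != 0 -> (size p <= q)%N ->
  (q * (size (lead_coef p)).-1 + q.+1 * (size p).-1
     < size (infinity_sub q p))%N.
Proof.
move=> p0 szp; rewrite ltnNge; apply/negP => /leq_sizeP/(_ _ (leqnn _)).
rewrite coef_infinity_sub // ?prednK ?size_poly_gt0 // => /eqP.
by rewrite -!lead_coefE !lead_coef_eq0 (negPf p0).
Qed.

(** Suppose c h = e d with c in F[x] nonzero. Both factors have y-degree less than [q], so after
    substitution the right side has degree at least q deg c + (q+1) q, while the left side has
    degree q deg c + q + 1. *)
Lemma hermitian_ndvd (F : finFieldType) (q : nat) (d : {poly {poly F}}) :
    (1 < q)%N -> (1 < size d)%N -> (size d <= q)%N ->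
  ~~ Pdiv.Idomain.dvdp d (hermitian_poly F q).
Proof.
move=> q1 d1 dq; apply/negP => /Pdiv.Idomain.dvdpP [[c e] /= c0 E].
have h0 : hermitian_poly F q != 0 by rewrite monic_neq0 ?monic_hermitian_poly.
have ch0 : c *: hermitian_poly F q != 0.
  by rewrite -mul_polyC mulf_neq0 ?polyC_eq0.
have := ch0; rewrite E mulf_eq0 => /norP [e0 d0].
have Dsz : q.+1 = (size e + size d).-1.
  by rewrite -size_mul // -E -mul_polyC size_Cmul // size_hermitian_poly.
have Dc : c = lead_coef e * lead_coef d.
  rewrite -lead_coefM -E lead_coefZ (monicP _) ?mulr1 //.
  exact: monic_hermitian_poly.
have le0 : lead_coef e != 0 by rewrite lead_coef_eq0.
have ld0 : lead_coef d != 0 by rewrite lead_coef_eq0.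
have := congr1 (infinity_sub q) E.
rewrite infinity_subZ infinity_subM infinity_sub_hermitian.
move/(congr1 (fun p : {poly F} => size p)).
have eq : (size e <= q)%N by lia.
have Di : ((size e).-1 + (size d).-1 = q)%N.
  by move: e0 d0; rewrite -!size_poly_gt0; lia.
have := size_infinity_sub e0 eq; have := size_infinity_sub d0 dq.
have szX : (0 < q)%N by apply: ltnW.
have : size (c \Po 'X^q) = ((size c).-1 * q).+1.
  have := size_comp_poly c 'X^q; rewrite size_polyXn /= => <-.
  by rewrite prednK // size_poly_gt0 comp_poly_eq0 ?size_polyXn.
have Dszc : (size c).-1 = ((size (lead_coef e)).-1 + (size (lead_coef d)).-1)%N.
  rewrite Dc size_mul //; move: le0 ld0; rewrite -!size_poly_gt0.
  by case: (size _) => // m _; case: (size _) => // n _; rewrite addnS.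
rewrite size_mulXn; last by rewrite comp_poly_eq0 ?size_polyXn.
move=> -> ltd lte Eszs.
have := size_polyMleq (infinity_sub q e) (infinity_sub q d).
have [ed0|ed0] := eqVneq (infinity_sub q e * infinity_sub q d) 0.
  by move: Eszs; rewrite ed0 size_poly0 addnS.
move: Eszs; rewrite size_mul //; first last.
- by apply: contraNneq ed0 => ->; rewrite mulr0.
- by apply: contraNneq ed0 => ->; rewrite mul0r.
have arith m m' i i' a b : (i + i' = q -> q * m + q.+1 * i < a ->
    q * m' + q.+1 * i' < b -> q.+1 + ((m + m') * q).+1 = (a + b).-1 -> False)%N.
  move=> D; have := leq_mul (leqnn q.+1) q1.
  by rewrite -[in X in (_ <= X)%N]D; lia.
by rewrite Dszc => Eszs _; apply: arith Di lte ltd Eszs.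
Qed.

(** * Powers of point ideals and divisibility along a branch *)

(** The product in the quotient is a remainder, and [T] will be only an approximate root, so a
    multiple of the modulus at [T] has to be carried along. *)
Lemma horner_qpolyM (A : comNzRingType) (h : {poly A}) (u v : {poly %/ h})
    (T : A) :
  exists w, (u * v : {poly %/ h}).[T]
    = (u : {poly A}).[T] * (v : {poly A}).[T] - w * (mk_monic h).[T].
Proof.
pose p := (u : {poly A}) * (v : {poly A}).
exists (Pdiv.Ring.rdivp p (mk_monic h)).[T].
have := congr1 (fun p => p.[T]) (Pdiv.RingMonic.rdivp_eq (monic_mk_monic h) p).
by rewrite hornerD !hornerM => ->; rewrite addrAC subrr add0r.
Qed.

Lemma horner2_map (A : comNzRingType) (p : {poly {poly A}}) (T : {poly A})
    (a : A) :
  p.[T].[a] = (map_poly (horner_eval a) p).[T.[a]].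
Proof. by rewrite -[T.[a]]/(horner_eval a T) horner_map. Qed.

(** Each factor from the point ideal vanishes at [P], hence contributes one factor x - a after y :=
    T; the reduction error is absorbed because [s <= r]. *)
Lemma point_ideal_pow_dvd (F : finFieldType) (q r s : nat) (P : F * F)
    (T : {poly F}) (f : {poly %/ hermitian_poly F q}) :
    (1 < q)%N -> T.[P.1] = P.2 ->
    ('X - P.1%:P) ^+ r %| (hermitian_poly F q).[T] -> (s <= r)%N ->
    ideal_pow (@point_ideal F q P) s f ->
  ('X - P.1%:P) ^+ s %| (f : {poly {poly F}}).[T].
Proof.
move=> q1 TP dvdh; elim: s f => [|s IHs] f sr; first by rewrite expr0 dvd1p.
move=> [n [u [v [Iu Iv ->]]]].
rewrite poly_of_qpoly_sum horner_sum.
apply: (big_ind (fun p => _ %| p)); [exact: dvdp0|exact: dvdp_add|move=> i _].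
have [w ->] := horner_qpolyM (u i) (v i) T.
rewrite dvdp_sub //; last first.
  rewrite mk_monic_hermitian // dvdp_mull //.
  by rewrite (dvdp_trans _ dvdh) // dvdp_exp2l.
rewrite exprS dvdp_mul //; last exact: IHs (ltnW sr) (Iv i).
have := Iu i; rewrite /point_ideal /curve_eval => uP.
by rewrite dvdp_XsubCl /root horner2_map TP -uP horner2_map hornerC.
Qed.

Lemma dvdp_XsubC_exp_eq0 (F : fieldType) (a : F) (p : {poly F}) :
  (forall r, ('X - a%:P) ^+ r %| p) -> p = 0.
Proof.
move=> dvd_p; apply/eqP; apply: contraT => p0.
have := dvdp_leq p0 (dvd_p (size p)).
by rewrite size_exp_XsubC ltnn.
Qed.

Lemma size_hermitian_ring (F : finFieldType) (q : nat)
    (f : {poly %/ hermitian_poly F q}) :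
  (1 < q)%N -> (size (f : {poly {poly F}}) <= q)%N.
Proof.
move=> q1; apply: leq_trans (size_npoly f) _.
by rewrite mk_monic_hermitian // size_hermitian_poly.
Qed.

Lemma point_ideal_pow_neq0 (F : finFieldType) (q : nat) (P : F * F)
    (f : {poly %/ hermitian_poly F q}) :
    (1 < q)%N -> [pchar {poly F}].-nat q -> on_curve q P ->
  f != 0 -> exists s, ~ ideal_pow (@point_ideal F q P) s f.
Proof.
move=> q1 Fq onP f0; apply: contrapT => /forallNP If.
pose g : {poly {poly F}} := f.
have {}f0 : g != 0 by [].
have szg : (size g <= q)%N by apply: size_hermitian_ring.
have dvdT r : exists2 T : {poly F}, ('X - P.1%:P) ^+ r %| g.[T] &
    ('X - P.1%:P) ^+ r %| (hermitian_poly F q).[T].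
  have [T TP dvdh] := hermitian_local_branch r q1 Fq onP.
  exists T => //; apply: (point_ideal_pow_dvd q1 TP dvdh) => //.
  exact: contrapT (If r).
(* In y-degree 0, [g] is a polynomial in x and [T] drops out; the resultant argument needs positive
   y-degree. *)
have [g1|g1] := leqP (size g) 1.
  have [c Dg] : exists c, g = c%:P by exists g`_0; apply: size1_polyC.
  case/negP: f0; rewrite Dg polyC_eq0; apply/eqP.
  apply: (@dvdp_XsubC_exp_eq0 _ P.1) => r.
  by have [T + _] := dvdT r; rewrite Dg hornerC.
have h1 : (1 < size (hermitian_poly F q))%N.
  by rewrite size_hermitian_poly // ltnS ltnW.
have [[u v] /= _ Dres] := resultant_in_ideal g1 h1.
(* A zero resultant gives a common factor of y-degree between 1 and q - 1, which [hermitian_ndvd]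
   excludes. *)
suff : resultant g (hermitian_poly F q) = 0.
  move/eqP; rewrite resultant_eq0 => gcd1.
  have := @hermitian_ndvd F q _ q1 gcd1.
  rewrite Pdiv.Idomain.dvdp_gcdr => /(_ _)/negP; apply=> //.
  by rewrite (leq_trans _ szg) // Pdiv.Idomain.leq_gcdpl.
(* The branch [T] depends on [r], but the resultant does not. *)
apply: (@dvdp_XsubC_exp_eq0 _ P.1) => r; have [T dvdg dvdh] := dvdT r.
have := congr1 (fun p : {poly {poly F}} => p.[T]) Dres.
by rewrite hornerC hornerD !hornerM => ->; rewrite dvdp_add ?dvdp_mull.
Qed.

(** * Divisibility by powers of x - a *)

Lemma dvdp_coef_of_fibre (F : fieldType) (a : F) (n m : nat) (b : 'I_n -> F)
    (p : {poly {poly F}}) :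
    injective b -> (size p <= n)%N ->
    (forall i, exists2 T : {poly F}, T.[a] = b i &
       ('X - a%:P) ^+ m %| p.[T]) ->
  forall j, ('X - a%:P) ^+ m %| p`_j.
Proof.
move=> b_inj; elim: m p => [|m IHm] p szp dvd_p j; first by rewrite expr0 dvd1p.
have Xa0 : 'X - a%:P != 0 by rewrite polyXsubC_eq0.
(* At x = a the polynomial has the [n] distinct roots [b i] but degree less than [n]. *)
have p_a0 : map_poly (horner_eval a) p = 0.
  apply/eqP; apply: contraT => pa0.
  suff : (size [seq b i | i <- enum 'I_n] < n)%N.
    by rewrite size_map size_enum_ord ltnn.
  apply: leq_trans (leq_trans (size_poly _ _) szp).
  apply: max_poly_roots pa0 _ _; last by rewrite map_inj_uniq ?enum_uniq.
  apply/allP => _ /mapP [i _ ->]; have [T Ta] := dvd_p i.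
  rewrite exprS => /(dvdp_trans (dvdp_mulr _ (dvdpp _))).
  rewrite dvdp_XsubCl /root horner2_map Ta => /eqP pTa.
  exact/eqP.
have dvd_a i : 'X - a%:P %| p`_i.
  by rewrite dvdp_XsubCl /root -horner_evalE -coef_map p_a0 coef0.
pose p' := map_poly (fun u => u %/ ('X - a%:P)) p.
have Dp : p = ('X - a%:P) *: p'.
  apply/polyP => i; rewrite coefZ coef_map_id0 ?div0p //.
  by rewrite mulrC divpK.
rewrite Dp coefZ exprS dvdp_mul2l //; apply: IHm => [|i].
  exact: leq_trans (size_poly _ _) szp.
have [T Ta] := dvd_p i; rewrite {1}Dp hornerZ exprS dvdp_mul2l // => dvdT.
by exists T.
Qed.

Lemma prod_XsubC_exp_dvdp (F : fieldType) (n : nat) (a : 'I_n -> F)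
    (m : 'I_n -> nat) (p : {poly F}) :
    injective a -> (forall i, ('X - (a i)%:P) ^+ m i %| p) ->
  \prod_(i < n) ('X - (a i)%:P) ^+ m i %| p.
Proof.
move=> a_inj dvd_p; have := enum_uniq 'I_n; rewrite -big_enum /=.
elim: (enum _) => [|i s IHs]; first by rewrite big_nil dvd1p.
rewrite cons_uniq big_cons => /andP [i_s /IHs dvd_s].
rewrite Gauss_dvdp ?dvd_p //; elim: s i_s {IHs dvd_s} => [|j s IHs].
  by rewrite big_nil coprimep1.
rewrite inE negb_or big_cons coprimepMr => /andP [ij /IHs ->].
rewrite andbT coprimep_expl // coprimep_expr // coprimep_XsubC2 //.
by rewrite subr_eq0 (inj_eq a_inj) eq_sym.
Qed.

(** * Valuation bounds and the generators *)

Lemma val_at_geP (F : finFieldType) (q r : nat) (P : F * F)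
    (f : {poly %/ hermitian_poly F q}) :
    (1 < q)%N -> [pchar {poly F}].-nat q -> on_curve q P ->
  (r%:Z%:E <= val_at P f)%E <-> ideal_pow (@point_ideal F q P) r f.
Proof.
move=> q1 Fq onP; split; first exact: ideal_pow_of_val.
by apply: ideal_val_of_pow; apply: point_ideal_pow_neq0.
Qed.

Lemma in_qpoly_polyC (A : comNzRingType) (h : {poly A}) (k : A) :
  in_qpoly h k%:P = k%:A.
Proof. by rewrite -alg_polyC in_qpolyZ in_qpoly1. Qed.

Lemma x_sub_alg (F : finFieldType) (q : nat) (a : F) :
  x_ F q - (a%:P)%:A = ('X - a%:P)%:A.
Proof. by rewrite /x_ in_qpoly_polyC -scalerBl. Qed.

Lemma g_E (F : finFieldType) (q : nat) (alpha : 'I_(q ^ 2) -> F)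
    (mu : 'I_(q ^ 2) -> 'I_q -> nat) (f : 'I_q -> 'I_q -> {poly F}) (c : 'I_q) :
  g_ alpha mu f c = (\prod_(a < q ^ 2) ('X - (alpha a)%:P) ^+ mu a c) *:
    in_qpoly (hermitian_poly F q) (\prod_(b < q | (b < c)%N) ('X - (f b c)%:P)).
Proof.
rewrite /g_ rmorph_prod -[RHS]mulr_algl -in_algE rmorph_prod.
congr (_ * _); apply: eq_bigr => a _.
  by rewrite rmorphXn /= x_sub_alg.
by rewrite rmorphB /= in_qpoly_polyC.
Qed.

Lemma prod_lt_XsubC_monic (A : comNzRingType) (q : nat) (f : 'I_q -> A)
    (c : 'I_q) :
  let p := \prod_(b < q | (b < c)%N) ('X - (f b)%:P) in
  size p = c.+1 /\ p \is monic.
Proof.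
rewrite /= (big_ord_narrow (ltnW (ltn_ord c))).
rewrite -big_enum /=.
by rewrite size_prod_XsubC size_enum_ord monic_prod_XsubC.
Qed.

(** The product has y-degree [c < q], so it is its own representative. *)
Lemma polyn_g_ (F : finFieldType) (q : nat) (alpha : 'I_(q ^ 2) -> F)
    (mu : 'I_(q ^ 2) -> 'I_q -> nat) (f : 'I_q -> 'I_q -> {poly F}) (c : 'I_q) :
    (1 < q)%N ->
  (g_ alpha mu f c : {poly {poly F}}) =
    (\prod_(a < q ^ 2) ('X - (alpha a)%:P) ^+ mu a c) *:
    \prod_(b < q | (b < c)%N) ('X - (f b c)%:P).
Proof.
move=> q1; rewrite g_E poly_of_qpolyZ in_qpoly_small //.
rewrite mk_monic_hermitian // size_hermitian_poly //.
by have [-> _] := prod_lt_XsubC_monic (f^~ c) c; rewrite ltnS.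
Qed.

(** For [c <= b] the power of x - alpha_a already suffices; for [b < c] the factor y - f_{b,c}
    supplies the missing [mu a b - mu a c]. *)
Lemma g_in_ideal_pow (F : finFieldType) (q : nat) (alpha : 'I_(q ^ 2) -> F)
    (mu : 'I_(q ^ 2) -> 'I_q -> nat) (f : 'I_q -> 'I_q -> {poly F})
    (a : 'I_(q ^ 2)) (b c : 'I_q) (y0 : F) :
    (1 < q)%N -> on_curve q (alpha a, y0) ->
    (forall c : 'I_q, (b <= c)%N -> (mu a c <= mu a b)%N) ->
    (forall c : 'I_q, (c <= b)%N -> (mu a b <= mu a c)%N) ->
    (forall c : 'I_q, (b < c)%N ->
      ideal_pow (point_ideal (alpha a, y0)) (mu a b - mu a c)
        (y_ F q - (f b c)%:A)) ->
  ideal_pow (point_ideal (alpha a, y0)) (mu a b) (g_ alpha mu f c).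
Proof.
move=> q1 onP mu_ge mu_le If.
have Ix : ideal_pow (point_ideal (alpha a, y0)) (mu a c)
    (\prod_(a < q ^ 2) (x_ F q - ((alpha a)%:P)%:A) ^+ mu a c).
  rewrite (bigD1 a) //= mulrC; apply/ideal_powMl/ideal_pow_exp.
  rewrite x_sub_alg -in_qpoly_polyC /point_ideal curve_eval_in_qpoly //.
  by rewrite hornerC hornerXsubC subrr.
have [bc|cb] := ltnP b c; last first.
  by rewrite /g_ mulrC; apply/ideal_powMl/ideal_pow_le/Ix/mu_le.
rewrite /g_ -(subnKC (mu_ge c (ltnW bc))); apply: ideal_powM => //.
by rewrite (bigD1 b) //= mulrC; apply/ideal_powMl/If.
Qed.

(** * Descent on the y-degree *)

Lemma Fx_span_addZ (F : finFieldType) (q n : nat)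
    (g : 'I_n -> {poly %/ hermitian_poly F q}) (u : {poly F}) (c : 'I_n)
    (h : {poly %/ hermitian_poly F q}) :
  Fx_span g h -> Fx_span g (h + u *: g c).
Proof.
move=> [v ->]; exists (fun i => v i + (if i == c then u else 0)).
rewrite [RHS](eq_bigr (fun i => v i *: g i + (if i == c then u *: g i else 0))).
  by rewrite big_split /= -big_mkcond big_pred1_eq.
by move=> i _; rewrite scalerDl; case: eqP => // _; rewrite scale0r.
Qed.

Lemma size_sub_lead (A : nzRingType) (n : nat) (p g : {poly A}) :
    (size p <= n.+1)%N -> (size g <= n.+1)%N -> p`_n = g`_n ->
  (size (p - g)%R <= n)%N.
Proof.
move=> szp szg pg; apply/leq_sizeP => j; rewrite leq_eqVlt coefB.
case/predU1P => [<-|nj]; first by rewrite pg subrr.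
by rewrite !nth_default ?subrr // (leq_trans _ nj).
Qed.

Theorem proposition7 (F : finFieldType) (q : nat)
  (hq : prime_power q) (hF : #|F| = (q ^ 2)%N)
  (alpha : 'I_(q ^ 2) -> F) (beta : 'I_(q ^ 2) -> 'I_q -> F)
  (halpha : injective alpha)
  (hbeta : forall a : 'I_(q ^ 2), injective (beta a))
  (hcurve : forall (a : 'I_(q ^ 2)) (b : 'I_q), on_curve q (alpha a, beta a b))
  (mu : 'I_(q ^ 2) -> 'I_q -> nat)
  (hmu : forall (a : 'I_(q ^ 2)) (b c : 'I_q),
     (b <= c)%N -> (mu a c <= mu a b)%N)
  (f : 'I_q -> 'I_q -> {poly F})
  (hf : forall b c : 'I_q, (b < c)%N -> forall a : 'I_(q ^ 2),
     (((mu a b)%:Z - (mu a c)%:Z)%R%:E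
        <= val_at (alpha a, beta a b) (y_ F q - (f b c)%:A)%R)%E) :
  J_N alpha beta mu = Fx_span (g_ alpha mu f).
Proof.
have q1 := prime_power_gt1 hq; have Fq := pchar_nat_poly hq hF.
pose vanishes (h : {poly %/ hermitian_poly F q}) := forall a b,
  ideal_pow (@point_ideal F q (alpha a, beta a b)) (mu a b) h.
have JE h : J_N alpha beta mu h <-> vanishes h.
  by split=> Jh a b; have := Jh a b; rewrite val_at_geP.
have vD h1 h2 : vanishes h1 -> vanishes h2 -> vanishes (h1 + h2).
  by move=> v1 v2 a b; apply: ideal_powD.
have vZ u h : vanishes h -> vanishes (u *: h).
  by move=> vh a b; rewrite -mulr_algl; apply: ideal_powMl.
have vg c : vanishes (g_ alpha mu f c).
  move=> a b; apply: g_in_ideal_pow => // [c' /hmu|c' /hmu|c' bc'] //.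
  apply: ideal_pow_of_val; have := hf _ _ bc' a.
  (* The integer difference in [hf] is a natural one because [mu a] is nonincreasing. *)
  by rewrite subzn // hmu // ltnW.
apply/seteqP; split=> h; last first.
  move=> [u ->]; apply/JE; apply: (big_ind vanishes) => // [a b|c _].
    exact: ideal_pow0.
  exact: vZ.
move/JE.
suff span n : (n <= q)%N -> forall h, vanishes h ->
    (size (h : {poly {poly F}}) <= n)%N -> Fx_span (g_ alpha mu f) h.
  by move=> vh; apply: span (leqnn q) h vh (size_hermitian_ring h q1).
elim: n => [|n IHn] nq {}h vh szh.
  exists (fun=> 0); rewrite big1 => [|i _]; last by rewrite scale0r.
  by apply/val_inj/eqP; rewrite -size_poly_leq0.
(* Indices start at 0, so [g_] at [c] has y-degree exactly [n], with leading coefficient [A]. *)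
pose c := Ordinal nq; pose A := \prod_(a < q ^ 2) ('X - (alpha a)%:P) ^+ mu a c.
have A_dvd : A %| (h : {poly {poly F}})`_n.
  apply: prod_XsubC_exp_dvdp => // a.
  (* The first n + 1 points over alpha_a are used: their multiplicities are at least [mu a c]. *)
  apply: (@dvdp_coef_of_fibre _ _ _ _ (beta a \o widen_ord nq)) szh _ _.
    by move=> i j /(hbeta a)/(congr1 val) ij; apply: val_inj.
  move=> i; pose b := widen_ord nq i.
  have [T Ta dvdT] := hermitian_local_branch (mu a c) q1 Fq (hcurve a b).
  exists T => //; apply: (point_ideal_pow_dvd q1 Ta dvdT (leqnn _)).
  by apply: ideal_pow_le (vh a b); apply: hmu; rewrite -ltnS /= ltn_ord.
pose u := (h : {poly {poly F}})`_n %/ A.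
rewrite -(subrK (u *: g_ alpha mu f c) h); apply: Fx_span_addZ.
apply: IHn => [||]; first exact: ltnW.
  by rewrite -scaleNr; apply: vD => //; apply: vZ.
rewrite (_ : polyn _ =
  (h : {poly {poly F}}) - u *: (g_ alpha mu f c : {poly {poly F}})) //.
have [szg /monicP] := prod_lt_XsubC_monic (f^~ c) c.
rewrite lead_coefE szg polyn_g_ // -/A => lead1.
apply: size_sub_lead => //.
  rewrite (leq_trans (size_scale_leq _ _)) //.
  by rewrite (leq_trans (size_scale_leq _ _)) ?szg.
by rewrite !coefZ mulrA divpK // lead1 mulr1.
Qed.
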